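(* Let $G$ and $H$ be rooted digraphs, let $p>0$ be real, let $k\in\mathbb{N}$, and let $\phi$ be a $k$-robust map from $G$ to $H$. If Angel wins the fractional $p$-Devil game on $H$, then Angel wins the fractional $pk$-Devil game on $G$.
   Context: If $G,H$ have roots $g_0,h_0$, a $k$-robust map from $G$ to $H$ is a map $\phi:V(G)\to V(H)$ with $\phi(g_0)=h_0$ such that whenever $\phi(v)\to w$ is an edge of $H$, there are at least $k$ vertices $z$ of $G$ with $\phi(z)=w$ and $v\to z$ an edge of $G$. The fractional $p$-Devil game on a rooted digraph: each vertex has a damage value in $[0,1]$, initially $0$; Angel starts at the root; players alternate, Angel first; Angel moves from his current vertex to an out-neighbor whose damage is less than $1$; Devil on his turn increases damages on a finite set of vertices by total amount at most $p$ (damage never decreases, and is capped at $1$). Devil wins if Angel is ever unable to move; Angel wins if he can move forever. *)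

(* Defs.v *)
From HB Require Import structures.
From mathcomp Require Import all_boot all_order all_algebra.
From mathcomp Require Import all_classical all_reals.

Set Implicit Arguments.
Unset Strict Implicit.
Unset Printing Implicit Defensive.

Import Order.TTheory GRing.Theory Num.Theory.

Local Open Scope classical_set_scope.
Local Open Scope card_scope.
Local Open Scope ring_scope.

(* The vertex set may be infinite and out-degrees may be infinite; classically,
   requiring a choiceType is no restriction on it. *)
Record rooted_digraph := RootedDigraph {
  vertex :> choiceType;
  edge : vertex -> vertex -> Prop;
  root : vertex }.

Arguments edge {r}.
Arguments root : clear implicits.

Definition robust_map (k : nat) (G H : rooted_digraph) (phi : G -> H) : Prop :=
  phi (root G) = root H /\
  forall (v : G) (w : H), edge (phi v) w ->
    `I_k #<= [set z : G | phi z = w /\ edge v z].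

Section FractionalGame.
Context {R : realType} (G : rooted_digraph).

Definition damage : Type := G -> R.

Definition angel_move (d : damage) (x y : G) : Prop := edge x y /\ d y < 1.

(* The finiteness clause is needed separately: the sum over an infinite
   support is 0 by convention. *)
Definition devil_move (p : R) (d d' : damage) : Prop :=
  [/\ forall v, d v <= d' v <= 1,
      finite_set [set v | d' v != d v] &
      \sum_(v \in [set: G]) (d' v - d v) <= p].

(* A strategy may use the whole history: given the pairs (Angel's vertex,
   current damage) at each of Angel's turns so far, oldest first and including
   the present turn, it names the vertex to move to. *)
Definition angel_strategy : Type := seq (G * damage) -> G.

(* [a n] and [d n] are Angel's vertex and the damage just before Angel's
   [n]-th move (counting from 0); in round [n] Angel moves from [a n] to
   [a n.+1], and then Devil changes [d n] to [d n.+1]. The legality of Angel's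
   moves is not assumed here. *)
Definition play (p : R) (s : angel_strategy)
    (a : nat -> G) (d : nat -> damage) : Prop :=
  [/\ a 0%N = root G,
      forall v, d 0%N v = 0,
      forall n, a n.+1 = s (mkseq (fun i => (a i, d i)) n.+1) &
      forall n, devil_move p (d n) (d n.+1)].

(* Since Devil may always pass, every finite play extends to an infinite one,
   so it suffices to quantify over infinite ones. *)
Definition winning_strategy (p : R) (s : angel_strategy) : Prop :=
  forall a d, play p s a d -> forall n, angel_move (d n) (a n) (a n.+1).

Definition angel_wins (p : R) : Prop := exists s, winning_strategy p s.

End FractionalGame.

(* Main.v *)
Require Import Defs.
From mathcomp Require Import all_boot all_order all_algebra.
From mathcomp Require Import finmap.
From mathcomp Require Import all_classical all_reals.

(** Angel playing on [G] imagines a game on [H] in which a vertex [w] carries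
    damage [min 1 (S / k)], where [S] is the total damage on the fibre of [w].
    A Devil move of cost at most [p * k] on [G] becomes one of cost at most [p]
    on [H], so the winning strategy on [H] always names some [w] of damage
    less than [1]. The total damage over [w] is then less than [k], so one of
    the [k] out-neighbours lying over [w] has damage less than [1]. *)

Set Implicit Arguments.
Unset Strict Implicit.
Unset Printing Implicit Defensive.

Import Order.TTheory GRing.Theory Num.Theory.

Local Open Scope classical_set_scope.
Local Open Scope card_scope.
Local Open Scope ring_scope.

(** Fibres may be infinite, but [f] vanishes off the finite set [A], so only points of [A]
    contribute. This turns fibre sums into list sums that can be regrouped. *)
Lemma fsum_fibre (R : realType) (I J : choiceType) (h : I -> J)
    (A : {fset I}) (f : I -> R) (w : J) : (forall z, z \notin A -> f z = 0) ->
  \sum_(z \in h @^-1` [set w]) f z = \sum_(z <- A | h z == w) f z.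
Proof.
move=> fA; rewrite fsbig_mkcond (fsbigTE A).
  rewrite [RHS]big_mkcond; apply: eq_bigr => z _; rewrite /patch.
  case: ifPn; first by rewrite inE /= => ->; rewrite eqxx.
  by rewrite notin_setE /= => /eqP /negbTE ->.
by move=> z zA; rewrite /patch fA // if_same.
Qed.

(** Truncation at 1 is 1-Lipschitz, so capping never raises the cost of a projected Devil move. *)
Lemma min1B_le (R : realType) (x y : R) :
  x <= y -> Num.min 1 y - Num.min 1 x <= y - x.
Proof.
move=> xy; case: (leP 1 y) => hy; case: (leP 1 x) => hx.
- by rewrite subrr subr_ge0.
- by rewrite lerD2r.
- by have := lt_le_trans hy (le_trans hx xy); rewrite ltxx.
- by [].
Qed.

Section Projection.
Context {R : realType} {G H : rooted_digraph} (k : nat) (phi : G -> H).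
Hypothesis k_gt0 : (0 < k)%N.

(** The sum defaults to 0 when infinitely many vertices of the fibre are damaged; hence the
    finite-support hypotheses below. *)
Definition fibre_damage (d : damage (R := R) G) : damage (R := R) H :=
  fun w => Num.min 1 ((\sum_(z \in phi @^-1` [set w]) d z) / k%:R).

Lemma fibre_damage0 d w : (forall v, d v = 0) -> fibre_damage d w = 0.
Proof.
by move=> d0; rewrite /fibre_damage fsbig1 // mul0r min_r // ler01.
Qed.

(** The fibres are disjoint, so the uncapped increments on [H] add up to the total increment on [G]
    divided by [k]; the cap only lowers them. *)
Lemma fibre_damage_move (p : R) (d d' : damage G) :
  finite_set [set v | d v != 0] ->
  devil_move (p * k%:R) d d' -> devil_move p (fibre_damage d) (fibre_damage d').
Proof.
move=> fd [dd' fdd' sdd'].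
have k0 : 0 < k%:R :> R by rewrite ltr0n.
(* [A] supports both [d] and [d'], so a single finite index set serves every sum. *)
pose A := fset_set ([set v | d v != 0] `|` [set v | d' v != d v]).
have [dA d'A] : (forall z, z \notin A -> d z = 0) /\
                (forall z, z \notin A -> d' z = 0).
  suff dA z : z \notin A -> d z = 0 /\ d' z = 0 by split=> z /dA[].
  rewrite in_fset_set ?finite_setU // notin_setE => /not_orP[] /=.
  by move=> /negP/negPn/eqP -> /negP/negPn/eqP.
pose S (f : G -> R) w := \sum_(z <- A | phi z == w) f z.
have ed w : fibre_damage d w = Num.min 1 (S d w / k%:R).
  by rewrite /fibre_damage (fsum_fibre phi w dA).
have ed' w : fibre_damage d' w = Num.min 1 (S d' w / k%:R).
  by rewrite /fibre_damage (fsum_fibre phi w d'A).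
have Sle w : S d w / k%:R <= S d' w / k%:R.
  rewrite ler_pM2r ?invr_gt0 //; apply: ler_sum => z _.
  by case/andP: (dd' z).
have eqS w : w \notin [fset phi z | z in A]%fset ->
    fibre_damage d' w - fibre_damage d w = 0.
  move=> wA; have S0 f : S f w = 0.
    rewrite /S big_seq_cond; apply: big1 => z /andP[zA /eqP zw].
    by case/negP: wA; rewrite -zw; exact: in_imfset.
  by rewrite ed ed' !S0 subrr.
split=> [w||].
- rewrite ed ed'; apply/andP; split; last by rewrite ge_min lexx.
  by rewrite le_min !ge_min lexx Sle orbT.
- apply: (sub_finite_set _ (finite_fset [fset phi z | z in A]%fset)) => w /=.
  by apply: contra_neqT => /eqS /eqP; rewrite subr_eq0 => /eqP.
rewrite (@fsbigTE _ _ _ _ _ _ eqS).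
apply: (@le_trans _ _
  (\sum_(w <- [fset phi z | z in A]%fset) (S (fun z => d' z - d z) w) / k%:R)).
  apply: ler_sum => w _; rewrite ed ed' /S sumrB mulrBl.
  exact: min1B_le (Sle w).
rewrite -mulr_suml -partition_big_imfset ler_pdivrMr //.
by rewrite -(fsbigTE A) // => z zA; rewrite dA ?d'A ?subrr.
Qed.

Lemma fibre_damage_lt1 (d : damage G) (v : G) (w : H) :
  finite_set [set z | d z != 0] -> (forall z, 0 <= d z) ->
  `I_k #<= [set z | phi z = w /\ edge v z] -> fibre_damage d w < 1 ->
  exists z, [/\ phi z = w, edge v z & d z < 1].
Proof.
move=> fd d0 kS; apply: contraPP => /forallNP noz.
have k0 : 0 < k%:R :> R by rewrite ltr0n.
apply/negP; rewrite -leNgt le_min lexx /= ler_pdivlMr // mul1r.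
set S := [set z | phi z = w /\ edge v z] in kS.
have S1 z : S z -> 1 <= d z.
  by case=> zw vz; rewrite leNgt; apply/negP => dz; apply: (noz z).
(* The cardinality hypothesis allows an infinite [S]; under the negated conclusion [S] lies in the
   finite support of [d]. *)
have Sd : S `<=` [set z | d z != 0].
  by move=> z /S1 dz /=; rewrite gt_eqF // (lt_le_trans ltr01).
have fS : finite_set S := sub_finite_set Sd fd.
pose A := fset_set [set z | d z != 0].
have dA z : z \notin A -> d z = 0.
  by rewrite in_fset_set // notin_setE /= => /negP/negPn/eqP.
rewrite (fsum_fibre phi w dA).
have kcard : (k <= #|` fset_set S|)%N.
  have [n Sn] := (finite_setP _).1 fS.
  by rewrite (card_fset_set Sn) -card_le_II -(card_le_eqr Sn).
apply: (@le_trans _ _ (\sum_(z <- fset_set S) d z)).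
  apply: (@le_trans _ _ (\sum_(z <- fset_set S) 1)).
    by rewrite big_const_seq count_predT iter_addr_0 ler_nat.
  rewrite big_seq [leRHS]big_seq; apply: ler_sum => z.
  by rewrite in_fset_set // inE => /S1.
(* Both sums become sums over [A] of [d] masked by a set. As [S] lies in the fibre and [d] is
   nonnegative, they compare term by term. *)
rewrite -(fsum_fibre phi w dA) fsbig_mkcond.
rewrite (fsbigTE A); last first.
  by move=> z zA; rewrite /patch dA // if_same.
have -> : \sum_(z <- fset_set S) d z = \sum_(z \in [set: G]) patch (fun=> 0) S d z.
  by rewrite -fsbig_mkcond fsbig_finite.
rewrite (fsbigTE A); last first.
  by move=> z zA; rewrite /patch dA // if_same.
apply: ler_sum => z _; rewrite /patch.
case: ifPn => [|_]; last by case: ifP.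
by rewrite inE => -[zw _]; rewrite mem_set.
Qed.

End Projection.

Section Response.
Context {R : realType} {G : rooted_digraph} (s : angel_strategy (R := R) G).
Variable d : nat -> damage (R := R) G.

(** The strategy reads its own earlier moves, so whole histories are built by recursion and
    positions read off their last entries. *)
Fixpoint response_history n : seq (G * damage (R := R) G) :=
  if n is n'.+1 then
    rcons (response_history n') (s (response_history n'), d n)
  else [:: (Defs.root G, d 0%N)].

Definition response n := (last (Defs.root G, d 0%N) (response_history n)).1.

Lemma response_historyE n :
  response_history n = mkseq (fun i => (response i, d i)) n.+1.
Proof.
elim: n => [//|n IHn]; rewrite mkseqS -IHn /=.
by rewrite /response /= last_rcons.
Qed.

Lemma response_play (p : R) :
  (forall v, d 0%N v = 0) -> (forall n, devil_move p (d n) (d n.+1)) ->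
  play p s response d.
Proof.
move=> d0 dm; split=> // n.
by rewrite -response_historyE /response /= last_rcons.
Qed.

End Response.

Section PlayDamage.
Context {R : realType} {G : rooted_digraph}.
Variables (p : R) (d : nat -> damage (R := R) G).
Hypothesis d0 : forall v, d 0%N v = 0.
Hypothesis dm : forall n, devil_move p (d n) (d n.+1).

Lemma play_damage_ge0 n v : 0 <= d n v.
Proof.
elim: n => [|n IHn]; first by rewrite d0.
by have [/(_ v)/andP[le _] _ _] := dm n; apply: le_trans le.
Qed.

Lemma play_damage_finite n : finite_set [set v | d n v != 0].
Proof.
elim: n => [|n IHn].
  by apply: sub_finite_set (finite_set0 G) => v /=; rewrite d0 eqxx.
have [_ fin _] := dm n.
apply: (@sub_finite_set _ _ ([set v | d n v != 0] `|` [set v | d n.+1 v != d n v])).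
  move=> v /= dv; case: (eqVneq (d n v) 0) => [dn|]; [right|by left].
  by rewrite dn.
by rewrite finite_setU.
Qed.

End PlayDamage.

Section Lift.
Context {R : realType} {G H : rooted_digraph} (k : nat) (phi : G -> H).

(** Projecting the history on [G] entry by entry recovers the imagined history on [H], so no extra
    memory is kept. Neither default is reached when [s] is winning and the play is legal. *)
Definition lift_strategy (s : angel_strategy (R := R) H) :
    angel_strategy (R := R) G := fun h =>
  let x := last (Defs.root G, fun=> 0) h in
  let w := s [seq (phi y.1, fibre_damage k phi y.2) | y <- h] in
  xget (Defs.root G) [set z | [/\ phi z = w, edge x.1 z & x.2 z < 1]].

Lemma lift_strategy_winning (p : R) (s : angel_strategy H) :
  (0 < k)%N -> robust_map k phi ->
  winning_strategy p s -> winning_strategy (p * k%:R) (lift_strategy s).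
Proof.
move=> k0 [phi0 phiP] sP a d [a0 d0 aS dm].
pose e n := fibre_damage k phi (d n).
have fin := play_damage_finite d0 dm.
have em n : devil_move p (e n) (e n.+1) by apply: fibre_damage_move.
(* The imagined play is built from the projected damages alone, without reference to [a]; that [a]
   lies over [b] is proved afterwards by induction. *)
pose b := response s e.
have bplay : play p s b e.
  by apply: response_play => // w; apply: fibre_damage0.
have bP := sP _ _ bplay.
have [b0 _ bS _] := bplay.
(* All earlier positions must agree, not just the current one, because [s] sees the whole
   history. *)
have step n : (forall i, (i <= n)%N -> phi (a i) = b i) ->
    [/\ phi (a n.+1) = b n.+1, edge (a n) (a n.+1) & d n (a n.+1) < 1].
  move=> ab; have [bedge blt] := bP n.
  have [z zP] : exists z, [/\ phi z = b n.+1, edge (a n) z & d n z < 1].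
    apply: (fibre_damage_lt1 k0 (fin n) (play_damage_ge0 d0 dm n) _ blt).
    by apply: phiP; rewrite ab.
  have hist : [seq (phi y.1, fibre_damage k phi y.2) |
      y <- mkseq (fun i => (a i, d i)) n.+1] = mkseq (fun i => (b i, e i)) n.+1.
    rewrite -map_comp; apply/eq_in_map => i; rewrite mem_iota => /= /ab.
    by move=> ->.
  rewrite aS /lift_strategy hist -bS mkseqS last_rcons /=.
  set P := (X in xget _ X).
  by have : P (xget (Defs.root G) P) by apply: xgetPex; exists z.
have ab n : forall i, (i <= n)%N -> phi (a i) = b i.
  elim: n => [|n IHn] i; first by rewrite leqn0 => /eqP ->; rewrite a0 b0.
  rewrite leq_eqVlt ltnS => /predU1P[->|/IHn //].
  by have [] := step n IHn.
by move=> n; have [] := step n (ab n).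
Qed.

End Lift.

Theorem theorem14 (R : realType) (G H : rooted_digraph) (p : R) (hp : 0 < p)
    (k : nat) (hk : (0 < k)%N) (phi : G -> H) (hphi : robust_map k phi) :
  angel_wins H p -> angel_wins G (p * k%:R).
Proof.
move=> [s sP]; exists (lift_strategy k phi s).
exact: lift_strategy_winning.
Qed.
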